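(* For every formula $\varphi$: $\mathbf{D}^2_{\rm H}\vdash\varphi$ if and only if $\mathbf{D}_{\rm H}\vdash\varphi$.
   Context: Formulas are built from propositional variables and $\bot$ by $\to$ and $\Box$; other connectives are the usual classical abbreviations; the empty conjunction is $\top$ and the empty disjunction is $\bot$. $\Gamma,\Delta$ denote finite sets of formulas; commas denote union; $\Box\Gamma=\{\Box\gamma\mid\gamma\in\Gamma\}$. $\mathbf{GL}_{\rm H}$: axioms are all tautologies, $\Box(\varphi\to\psi)\to(\Box\varphi\to\Box\psi)$, $\Box(\Box\varphi\to\varphi)\to\Box\varphi$; rules are modus ponens and necessitation (from $\varphi$ infer $\Box\varphi$). $\mathbf{D}_{\rm H}$: axioms are all theorems of $\mathbf{GL}_{\rm H}$, $\neg\Box\bot$, and all $\Box(\Box\varphi\lor\Box\psi)\to\Box\varphi\lor\Box\psi$; the only rule is modus ponens. $\mathbf{D}^2_{\rm H}$: axioms are all tautologies and all formulas of the form $\bigwedge\Box\Gamma\to\bigvee\Box\Delta$ such that $\bigwedge(\Gamma,\Box\Gamma)\to\bigvee\Box\Delta$ is a theorem of $\mathbf{GL}_{\rm H}$; the only rule is modus ponens. *)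

(* Defs.v *)
From mathcomp Require Import all_boot.

Set Implicit Arguments.
Unset Strict Implicit.
Unset Printing Implicit Defensive.

Inductive form : Type :=
| Var of nat
| Bot
| Imp of form & form
| Box of form.

Definition Neg (a : form) : form := Imp a Bot.
Definition Top : form := Neg Bot.
Definition Or (a b : form) : form := Imp (Neg a) b.
Definition And (a b : form) : form := Neg (Imp a (Neg b)).

(* Finite sets of formulas are represented by arbitrary lists: union is [++],
   and the image under Box is [map Box].  Every order of enumeration (and every
   repetition) of a finite set is thus allowed in a conjunction or disjunction.
   The conjunction or disjunction of a singleton is its element. *)
Fixpoint bigAnd (s : seq form) : form :=
  match s with
  | [::] => Top
  | [:: a] => a
  | a :: s' => And a (bigAnd s')
  end.

Fixpoint bigOr (s : seq form) : form :=
  match s with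
  | [::] => Bot
  | [:: a] => a
  | a :: s' => Or a (bigOr s')
  end.

(* Boxed formulas are propositional atoms: [v] gives the truth values of the
   variables, and [w a] that of [Box a]. *)
Fixpoint eval (v : nat -> bool) (w : form -> bool) (a : form) : bool :=
  match a with
  | Var p => v p
  | Bot => false
  | Imp b c => eval v w b ==> eval v w c
  | Box b => w b
  end.

Definition tautology (a : form) : Prop := forall v w, eval v w a.

Inductive GL_H : form -> Prop :=
| GL_taut a : tautology a -> GL_H a
| GL_K a b : GL_H (Imp (Box (Imp a b)) (Imp (Box a) (Box b)))
| GL_Lob a : GL_H (Imp (Box (Imp (Box a) a)) (Box a))
| GL_mp a b : GL_H (Imp a b) -> GL_H a -> GL_H b
| GL_nec a : GL_H a -> GL_H (Box a).

Inductive D_H : form -> Prop :=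
| D_GL a : GL_H a -> D_H a
| D_con : D_H (Neg (Box Bot))
| D_disj a b :
    D_H (Imp (Box (Or (Box a) (Box b))) (Or (Box a) (Box b)))
| D_mp a b : D_H (Imp a b) -> D_H a -> D_H b.

Inductive D2_H : form -> Prop :=
| D2_taut a : tautology a -> D2_H a
| D2_refl (G D : seq form) :
    GL_H (Imp (bigAnd (G ++ map Box G)) (bigOr (map Box D))) ->
    D2_H (Imp (bigAnd (map Box G)) (bigOr (map Box D)))
| D2_mp a b : D2_H (Imp a b) -> D2_H a -> D2_H b.

(* Main.v *)
(* From D^2 to D: necessitating the premise of a reflection axiom and using
   [Box a -> Box Box a] gives [Box G -> Box (\/ Box D)] in GL, and the axioms
   of D collapse [Box (\/ Box D)] to [\/ Box D]: [~ Box Bot] when D is empty,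
   iterated disjunction axioms otherwise.  From D to D^2: every modal axiom of
   D is a single reflection axiom, and so is each use of necessitation in GL,
   because its premise is a theorem of GL. *)
From mathcomp Require Import all_boot.
Require Import Defs.

Set Implicit Arguments.
Unset Strict Implicit.
Unset Printing Implicit Defensive.

Lemma eval_impP v w a b :
  reflect (eval v w a -> eval v w b) (eval v w (Imp a b)).
Proof. exact: implyP. Qed.

Lemma eval_bigAnd v w s : eval v w (bigAnd s) = all (eval v w) s.
Proof.
elim: s => [|a [|b s] IHs] //; first by rewrite /= andbT.
have -> : eval v w (bigAnd (a :: b :: s))
  = eval v w a && eval v w (bigAnd (b :: s)).
  by move=> /=; do 2!case: (eval v w _).
by rewrite IHs.
Qed.

Lemma eval_bigOr v w s : eval v w (bigOr s) = has (eval v w) s.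
Proof.
elim: s => [|a [|b s] IHs] //; first by rewrite /= orbF.
have -> : eval v w (bigOr (a :: b :: s))
  = eval v w a || eval v w (bigOr (b :: s)).
  by move=> /=; do 2!case: (eval v w _).
by rewrite IHs.
Qed.

(** Since [eval] treats boxed formulas as atoms, this leaves only truth values to check once the
    modal input [a] is a theorem, whatever the syntactic shape of [bigAnd] and [bigOr]. *)
Lemma GL_entail1 a b :
  GL_H a -> (forall v w, eval v w a -> eval v w b) -> GL_H b.
Proof.
move=> Ha ab; apply: GL_mp Ha; apply: GL_taut => v w.
exact/eval_impP/ab.
Qed.

Lemma GL_entail2 a b c : GL_H a -> GL_H b ->
  (forall v w, eval v w a -> eval v w b -> eval v w c) -> GL_H c.
Proof.
move=> Ha Hb abc; apply: GL_mp Hb; apply: (GL_entail1 Ha) => v w va.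
exact/eval_impP/abc.
Qed.

Lemma D_entail2 a b c : D_H a -> D_H b ->
  (forall v w, eval v w a -> eval v w b -> eval v w c) -> D_H c.
Proof.
move=> Ha Hb abc; apply: D_mp Hb; apply: D_mp Ha.
apply/D_GL/GL_taut => v w; apply/eval_impP => va; exact/eval_impP/abc.
Qed.

Lemma GL_trans a b c : GL_H (Imp a b) -> GL_H (Imp b c) -> GL_H (Imp a c).
Proof.
move=> Hab Hbc; apply: (GL_entail2 Hab Hbc) => v w /=.
by do 3!case: (eval v w _).
Qed.

Lemma D_trans a b c : D_H (Imp a b) -> D_H (Imp b c) -> D_H (Imp a c).
Proof.
move=> Hab Hbc; apply: (D_entail2 Hab Hbc) => v w /=.
by do 3!case: (eval v w _).
Qed.

Lemma GL_box_mono a b : GL_H (Imp a b) -> GL_H (Imp (Box a) (Box b)).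
Proof. by move=> Hab; apply: GL_mp (GL_K a b) (GL_nec Hab). Qed.

(* Loeb's axiom for [And a (Box a)]. *)
Lemma GL_4 a : GL_H (Imp (Box a) (Box (Box a))).
Proof.
set c := And a (Box a).
have ca : GL_H (Imp (Box c) (Box a)).
  apply/GL_box_mono/GL_taut => v w /=.
  by case: (eval v w a); case: (w a).
have cba : GL_H (Imp (Box c) (Box (Box a))).
  apply/GL_box_mono/GL_taut => v w /=.
  by case: (eval v w a); case: (w a).
(* It remains to pass from [Box a] to [Box (Imp (Box c) c)]: under the box, [ca] turns [Box c] into
   [Box a], which together with [a] is [c]. *)
apply: GL_trans cba; apply: GL_trans (GL_Lob c).
apply: GL_box_mono; apply: (GL_entail1 ca) => v w /=.
by case: (eval v w a); case: (w a); case: (w c).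
Qed.

Lemma GL_bigAnd_box s : GL_H (Imp (bigAnd (map Box s)) (Box (bigAnd s))).
Proof.
elim: s => [|a s IHs].
  apply: (GL_entail1 (GL_nec (GL_taut (a := Top) _))) => // v w /= ->.
have Ha : GL_H (Imp (Box a) (Box (Imp (bigAnd s) (bigAnd (a :: s))))).
  apply/GL_box_mono/GL_taut => v w.
  apply/eval_impP => va; apply/eval_impP; rewrite !eval_bigAnd => vs.
  by rewrite /= va.
apply: (GL_entail2 (GL_trans Ha (GL_K _ _)) IHs) => v w /eval_impP Hw /eval_impP IHw.
apply/eval_impP; rewrite eval_bigAnd => /andP[wa ws].
by move/eval_impP: (Hw wa); apply; apply: IHw; rewrite eval_bigAnd.
Qed.

Lemma GL_bigAnd_4 s :
  GL_H (Imp (bigAnd (map Box s)) (bigAnd (map Box (map Box s)))).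
Proof.
elim: s => [|a s IHs]; first by apply: GL_taut.
apply: (GL_entail2 (GL_4 a) IHs) => v w /eval_impP Ha /eval_impP IHw.
apply/eval_impP; rewrite !eval_bigAnd => /andP[wa ws].
apply/andP; split; first exact: Ha.
by move: IHw; rewrite !eval_bigAnd; apply.
Qed.

(** [GL_bigAnd_4] supplies the boxes of [map Box s], and [GL_bigAnd_box] gathers all conjuncts under
    one box. The result is the necessitated antecedent of the premise of a reflection axiom. *)
Lemma GL_bigAnd_box4 s :
  GL_H (Imp (bigAnd (map Box s)) (Box (bigAnd (s ++ map Box s)))).
Proof.
apply: GL_trans (GL_bigAnd_box _).
apply: (GL_entail1 (GL_bigAnd_4 s)) => v w /eval_impP H4.
apply/eval_impP => ws; move: (ws) (H4 ws).
by rewrite !eval_bigAnd map_cat all_cat => -> ->.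
Qed.

Lemma GL_bigOr_4 s : GL_H (Imp (bigOr (map Box s)) (Box (bigOr (map Box s)))).
Proof.
(* The formula under the box is generalized to any consequence [t] of the disjunction, so that it
   stays fixed while the induction shortens the list. *)
suff Hs t : (forall v w, eval v w (bigOr (map Box s)) -> eval v w t) ->
    GL_H (Imp (bigOr (map Box s)) (Box t)) by apply: Hs.
elim: s => [|a s IHs] st; first by apply: GL_taut.
have Ha : GL_H (Imp (Box a) (Box t)).
  apply: GL_trans (GL_4 a) _; apply/GL_box_mono/GL_taut => v w.
  by apply/eval_impP => wa; apply: st; rewrite eval_bigOr; apply/orP; left.
have Hs : GL_H (Imp (bigOr (map Box s)) (Box t)).
  apply: IHs => v w; rewrite eval_bigOr => ws.
  by apply: st; rewrite eval_bigOr; apply/orP; right.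
apply: (GL_entail2 Ha Hs) => v w /eval_impP Haw /eval_impP; rewrite eval_bigOr => Hsw.
by apply/eval_impP; rewrite eval_bigOr => /orP[/Haw|/Hsw].
Qed.

Lemma D_box_bigOr s : D_H (Imp (Box (bigOr (map Box s))) (bigOr (map Box s))).
Proof.
elim: s => [|a s IHs]; first exact: D_con.
(* [D_disj] needs both disjuncts boxed, so [GL_bigOr_4] boxes the tail. After the split, the
   induction hypothesis removes that box; for an empty tail it is [D_con]. *)
have Hbox : GL_H (Imp (Box (bigOr (map Box (a :: s))))
                      (Box (Or (Box a) (Box (bigOr (map Box s)))))).
  apply: GL_box_mono; apply: (GL_entail1 (GL_bigOr_4 s)) => v w /eval_impP H4.
  apply/eval_impP; rewrite eval_bigOr => /orP[/= -> //|ws].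
  apply/eval_impP => _; apply: H4; by rewrite eval_bigOr.
apply: (D_entail2 (D_trans (D_GL Hbox) (D_disj _ _)) IHs) => v w /eval_impP Hw.
move=> /eval_impP IHw; apply/eval_impP => /Hw /eval_impP Hor.
case wa: (w a); first by rewrite eval_bigOr /= wa.
have: eval v w (bigOr (map Box s)) by apply/IHw/Hor; rewrite /= wa.
by rewrite !eval_bigOr /= wa.
Qed.

(** Reflection with empty [G]: its premise [Imp Top (Box a)] must hold in GL, and necessitation
    there provides it. *)
Lemma D2_nec a : GL_H a -> D2_H (Box a).
Proof.
move=> Ha.
have Htop : D2_H (Imp Top (Box a)).
  apply: (D2_refl (G := [::]) (D := [:: a])).
  by apply: (GL_entail1 (GL_nec Ha)) => v w /= ->.
by apply: D2_mp Htop (D2_taut _).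
Qed.

Lemma D2_K a b : D2_H (Imp (Box (Imp a b)) (Imp (Box a) (Box b))).
Proof.
(* Reflection yields the uncurried form of K, with both antecedents in one conjunction; a tautology
   curries it. *)
apply: D2_mp (D2_refl (G := [:: Imp a b; a]) (D := [:: b]) _); last first.
  apply: (GL_entail1 (GL_K a b)) => v w /=.
  by case: (eval v w a); case: (eval v w b); case: (w (Imp a b));
    case: (w a); case: (w b).
apply: D2_taut => v w /=.
by case: (w (Imp a b)); case: (w a); case: (w b).
Qed.

Lemma D2_Lob a : D2_H (Imp (Box (Imp (Box a) a)) (Box a)).
Proof.
apply: (D2_refl (G := [:: Imp (Box a) a]) (D := [:: a])).
apply: (GL_entail1 (GL_Lob a)) => v w /=.
by case: (w (Imp _ _)); case: (w a); case: (eval v w a).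
Qed.

Lemma GL_D2 a : GL_H a -> D2_H a.
Proof.
elim=> {a} [a /D2_taut // | a b | a | a b _ Hab _ Ha | a Ha _].
- exact: D2_K.
- exact: D2_Lob.
- exact: D2_mp Hab Ha.
- exact: D2_nec.
Qed.

Theorem theorem6p3 (phi : form) : D2_H phi <-> D_H phi.
Proof.
split; elim=> {phi}.
- by move=> a /GL_taut /D_GL.
(* The chain runs from the conjunction of [Box G] to the box of the premise's antecedent, then to
   the box of the disjunction of [Box D], and finally out of that box. *)
- move=> G D HGD; apply: D_trans (D_box_bigOr D); apply: D_GL.
  exact: GL_trans (GL_bigAnd_box4 G) (GL_box_mono HGD).
- by move=> a b _ Hab _; apply: D_mp.
- exact: GL_D2.
(* The unboxed [Bot] in the antecedent makes the premise a tautology. *)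
- by apply: (D2_refl (G := [:: Bot]) (D := [::])); apply: GL_taut.
(* The unboxed copy of the member of [G] is already the required disjunction. *)
- move=> a b; apply: (D2_refl (G := [:: Or (Box a) (Box b)]) (D := [:: a; b])).
  apply: GL_taut => v w /=.
  by case: (w a); case: (w b); case: (w _).
- by move=> a b _ Hab _; apply: D2_mp.
Qed.
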